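(* Let $W\in\mathbb{R}^{n\times n}$ be a nonnegative row stochastic irreducible matrix, and let $\alpha\in\mathbb{R}^n$ be the vector with nonnegative components such that $\alpha^T W=\alpha^T$ and $\alpha^T\mathbf{1}=1$. Let $\epsilon\in(0,1)$ and let $\tilde\Sigma=\mathrm{diag}(p_1,\dots,p_n)$ be a fixed diagonal matrix with $0<p_i\le 1$ for all $i$ and $\max_i p_i=1$. Let $y_0\in[0,1]^n$. For $\sigma_M\in(0,1-\epsilon]$ put $\Sigma=\sigma_M\tilde\Sigma$ and let $(y(k))_{k\ge 0}$ be the solution of $$y(k+1)=(I-\Sigma)Wy(k)+\Sigma y_0,\qquad y(0)=y_0 .$$ Then the limit $\bar y=\bar y(\sigma_M)=\lim_{k\to\infty}y(k)$ exists and $$\bar y=\bar H y_0+\mathcal{O}(\sigma_M),\qquad \bar H=\mathbf{1}\,\frac{\alpha^T\tilde\Sigma}{\alpha^T\tilde\Sigma\mathbf{1}},$$ i.e. there exist $\bar\sigma>0$ and $M'>0$ with $\|\bar y(\sigma_M)-\bar H y_0\|\le M'\sigma_M$ for all $\sigma_M\in(0,\bar\sigma]$. As a consequence, for any two indices $i,j\in\{1,\dots,n\}$ there exist $\bar\sigma_M>0$ and $M>0$ such that $$|\bar y_i-\bar y_j|<M\sigma_M\qquad\text{for all }\sigma_M\in(0,\bar\sigma_M].$$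
   Context: $\mathbf{1}$ denotes the column vector in $\mathbb{R}^n$ with all entries equal to $1$, and $I$ is the $n\times n$ identity matrix; $\|\cdot\|$ is the Euclidean norm. A nonnegative square matrix is row stochastic if each row sums to $1$, and irreducible if its associated directed graph is strongly connected. For such $W$, the value $1$ is a simple eigenvalue with right eigenvector $\mathbf{1}$, so the nonnegative normalized left eigenvector $\alpha^T$ exists and is unique. The recursion is the Friedkin-Johnsen opinion model; the entries of $y_0$ are the agents' initial opinions, taken in $[0,1]$. *)

(* Defs.v *)
From HB Require Import structures.
From mathcomp Require Export all_boot all_order all_algebra.
From mathcomp Require Export all_classical all_reals all_analysis.

Set Implicit Arguments.
Unset Strict Implicit.
Unset Printing Implicit Defensive.

Import Order.TTheory GRing.Theory Num.Theory.
Import numFieldNormedType.Exports.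
Local Open Scope classical_set_scope.
Local Open Scope ring_scope.

Section FriedkinJohnsen.
Context {R : realType} {n : nat}.

Definition ones : 'cV[R]_n := const_mx 1.

(* The library norm on matrices is the sup norm, hence this definition. *)
Definition enorm (v : 'cV[R]_n) : R := Num.sqrt (\sum_i v i 0 ^+ 2).

Definition nonneg_mx (W : 'M[R]_n) : Prop := forall i j, 0 <= W i j.

Definition row_stochastic (W : 'M[R]_n) : Prop :=
  nonneg_mx W /\ forall i, \sum_j W i j = 1.

(* [connect] is the reflexive transitive closure of the edge relation.
   Reversing all the arcs would not change strong connectivity. *)
Definition mx_digraph (W : 'M[R]_n) : rel 'I_n := fun i j => W i j != 0.

Definition irreducible_mx (W : 'M[R]_n) : Prop :=
  forall i j, connect (mx_digraph W) i j.

Fixpoint fj_state (W Sigma : 'M[R]_n) (y0 : 'cV[R]_n) (k : nat) : 'cV[R]_n :=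
  if k is k'.+1 then
    (1%:M - Sigma) *m W *m fj_state W Sigma y0 k' + Sigma *m y0
  else y0.

(* Meaningful only when [fj_state W (s *: St) y0] converges. *)
Definition fj_limit (W St : 'M[R]_n) (y0 : 'cV[R]_n) (s : R) : 'cV[R]_n :=
  limn (fj_state W (s *: St) y0).

Definition Hbar (alpha : 'cV[R]_n) (St : 'M[R]_n) : 'M[R]_n :=
  ((alpha^T *m St *m ones) 0 0)^-1 *: (ones *m (alpha^T *m St)).

End FriedkinJohnsen.

(* Main.v *)
(* Each step of the recursion is a sup-norm contraction whose fixed point x obeys
   |x| <= |y0| and x - W x = s St (y0 - W x). Irreducibility makes
   B = 1 - W + ones alpha^T invertible, and B (x - ones (alpha^T x)) = x - W x, so
   x is O(s)-close to a constant vector. Pairing x - W x with alpha^T gives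
   b y0 = b W x for b = alpha^T St, whence x - Hbar y0 = T x with
   T = 1 - (b ones)^-1 ones (b W); since T ones = 0, this equals
   T B^-1 (x - W x) = s T B^-1 St (y0 - W x), which is O(s). *)
Require Import Defs.

Set Implicit Arguments.
Unset Strict Implicit.

Import Order.TTheory GRing.Theory Num.Theory.
Import numFieldNormedType.Exports.
Local Open Scope classical_set_scope.
Local Open Scope ring_scope.

(** * Sup norm of matrices, and its comparison with the Euclidean norm *)

Lemma ler_mx_norm_entry (R : realType) (m n : nat) (A : 'M[R]_(m, n)) i j :
  `|A i j| <= `|A|.
Proof.
rewrite [leRHS]/Num.Def.normr /= mx_normrE.
by apply: (le_bigmax _ (fun ij => `|A ij.1 ij.2|) (i, j)).
Qed.

Lemma mx_norm_le (R : realType) (m n : nat) (A : 'M[R]_(m, n)) (c : R) :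
  0 <= c -> (forall i j, `|A i j| <= c) -> `|A| <= c.
Proof.
move=> c_ge0 Ac; rewrite [leLHS]/Num.Def.normr /= mx_normrE.
by apply: bigmax_le => // ij _.
Qed.

(** [A != 0] rules out the empty matrix, whose norm is the default 0 and has no entry to attain
    it. *)
Lemma mx_norm_attained (R : realType) (m n : nat) (A : 'M[R]_(m, n)) :
  A != 0 -> exists i j, `|A| = `|A i j|.
Proof.
rewrite -normr_eq0 => /mx_norm_neq0[[i j] Aij].
by exists i, j.
Qed.

Lemma ler_norm_mulmx (R : realType) (m n p : nat)
    (A : 'M[R]_(m, n)) (B : 'M[R]_(n, p)) :
  `|A *m B| <= n%:R * `|A| * `|B|.
Proof.
apply: mx_norm_le => [|i j]; first by rewrite !mulr_ge0.
rewrite mxE (le_trans (ler_norm_sum _ _ _)) //.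
apply: (@le_trans _ _ (\sum_(k < n) `|A| * `|B|)).
  by apply: ler_sum => k _; rewrite normrM ler_pM // ler_mx_norm_entry.
by rewrite sumr_const card_ord -mulrA mulr_natl.
Qed.

Lemma enorm_le (R : realType) (n : nat) (v : 'cV[R]_n) :
  enorm v <= Num.sqrt n%:R * `|v|.
Proof.
rewrite -[`|v|]normr_id -sqrtr_sqr -sqrtrM // ler_wsqrtr //.
apply: (@le_trans _ _ (\sum_(i < n) `|v| ^+ 2)).
  apply: ler_sum => i _; rewrite -real_normK ?num_real //.
  by rewrite lerXn2r ?nnegrE // ler_mx_norm_entry.
by rewrite sumr_const card_ord mulr_natl.
Qed.

(** * Row stochastic matrices and the maximum principle *)

Section Stochastic.
Context {R : realType} {n : nat} (W : 'M[R]_n).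
Hypothesis W_stochastic : row_stochastic W.

Lemma stochastic_ones : W *m ones = ones.
Proof.
apply/colP => i; rewrite !mxE -[RHS](W_stochastic.2 i).
by apply: eq_bigr => j _; rewrite mxE mulr1.
Qed.

Lemma stochastic_contract (v : 'cV[R]_n) : `|W *m v| <= `|v|.
Proof.
apply: mx_norm_le => // i j.
rewrite mxE (le_trans (ler_norm_sum _ _ _)) //.
rewrite -[leRHS]mul1r -(W_stochastic.2 i) mulr_suml ler_sum // => k _.
rewrite normrM (ger0_norm (W_stochastic.1 i k)).
by rewrite ler_wpM2l ?W_stochastic.1 ?ler_mx_norm_entry.
Qed.

(** Maximum principle: if [x] is maximal at [a], the weighted gaps [W a c * (max - x c)] are
    nonnegative and sum to 0, so every out-neighbour of [a] is a maximiser too. Strong connectivity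
    carries this from one maximiser [k] to every index. *)
Lemma harmonic_const (x : 'cV[R]_n) :
  irreducible_mx W -> W *m x = x -> forall i j, x i 0 = x j 0.
Proof.
move=> W_irr Wx i j.
have [k _ kmax] := @arg_maxP _ _ _ i xpredT (fun i => x i 0) isT.
suff xk l : x l 0 = x k 0 by rewrite !xk.
have step a b : mx_digraph W a b -> x a 0 = x k 0 -> x b 0 = x k 0.
  rewrite /mx_digraph => Wab xa.
  have sum0 : \sum_c W a c * (x k 0 - x c 0) = 0.
    under eq_bigr do rewrite mulrBr.
    rewrite sumrB -mulr_suml W_stochastic.2 mul1r.
    by move/colP: Wx => /(_ a); rewrite mxE xa => ->; rewrite subrr.
  have terms_ge0 c : true -> 0 <= W a c * (x k 0 - x c 0).
    by move=> _; rewrite mulr_ge0 ?W_stochastic.1 // subr_ge0; exact: kmax.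
  apply/eqP; rewrite eq_sym -subr_eq0.
  have /eqP := psumr_eq0P terms_ge0 sum0 (i := b) isT.
  by rewrite mulf_eq0 (negPf Wab).
have /connectP[s + ->] := W_irr k l.
elim/last_ind: s => [//|s a IH]; rewrite rcons_path last_rcons.
by move=> /andP[/IH xs /step]; exact.
Qed.

(** * Fixed point and convergence for one stubbornness matrix [diag_mx t] *)

Section FriedkinJohnsenLimit.
Context (t : 'rV[R]_n).
Hypothesis t_bounds : forall i, 0 < t 0 i <= 1.

Lemma stubborn_entry (v : 'cV[R]_n) i :
  ((1%:M - diag_mx t) *m v) i 0 = (1 - t 0 i) * v i 0.
Proof. by rewrite mulmxBl mul1mx mul_diag_mx !mxE mulrBl mul1r. Qed.

(** At an entry where [|x|] is attained, the equation is a convex combination of an entry of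
    [W *m x], at most [|x|] in absolute value, and an entry of [b]. The weight [t 0 i > 0] of the
    latter can be cancelled. *)
Lemma fj_fixpoint_bound (x b : 'cV[R]_n) :
  x = (1%:M - diag_mx t) *m W *m x + diag_mx t *m b -> `|x| <= `|b|.
Proof.
move=> xE; have [->|x0] := eqVneq x 0; first by rewrite normr0.
have [i [j xij]] := mx_norm_attained x0; move: xij; rewrite ord1 => xi.
have /andP[ti0 ti1] := t_bounds i.
have: `|x| <= (1 - t 0 i) * `|x| + t 0 i * `|b|.
  rewrite {1}xi {1}xE mxE -mulmxA stubborn_entry mul_diag_mx [X in _ + X]mxE.
  rewrite (le_trans (ler_normD _ _)) // !normrM.
  rewrite (ger0_norm (ltW ti0)) ger0_norm ?subr_ge0 //.
  rewrite lerD ?ler_wpM2l ?subr_ge0 ?(ltW ti0) ?ler_mx_norm_entry //.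
  by rewrite (le_trans (ler_mx_norm_entry _ _ _)) // stochastic_contract.
by rewrite mulrBl mul1r -addrA lerDl addrC subr_ge0 ler_pM2l.
Qed.

(** Uniqueness gives existence: by the previous bound with [b = 0], the square matrix [1%:M - A] has
    trivial kernel. Transposition turns the row vectors of [inj_row_free] into columns. *)
Lemma fj_fixpoint_exists (b : 'cV[R]_n) :
  exists x, x = (1%:M - diag_mx t) *m W *m x + diag_mx t *m b.
Proof.
set A := _ *m W; have Au : 1%:M - A \in unitmx.
  rewrite -unitmx_tr -row_free_unit; apply: inj_row_free => v.
  move/(congr1 trmx); rewrite trmx_mul trmxK trmx0 mulmxBl mul1mx.
  move/subr0_eq => vA; apply/trmx_inj/eqP.
  rewrite trmx0 -normr_le0 -[leRHS](@normr0 _ 'cV[R]_n).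
  by apply: fj_fixpoint_bound; rewrite mulmx0 addr0.
set c := diag_mx t *m b; exists (invmx (1%:M - A) *m c); set x := _ *m c.
have <- : (1%:M - A) *m x = c by exact: mulKVmx.
by rewrite mulmxBl mul1mx addrC subrK.
Qed.

(** One step shrinks the distance to the fixed point by [q], the largest [1 - t 0 i], which is below
    1 because all [t 0 i] are positive. *)
Lemma fj_state_cvg (x y0 : 'cV[R]_n) :
  x = (1%:M - diag_mx t) *m W *m x + diag_mx t *m y0 ->
  fj_state W (diag_mx t) y0 @ \oo --> x.
Proof.
move=> xE; pose q := `|const_mx 1 - t|.
have q_lt1 : `|q| < 1.
  rewrite normr_id; have [-> |t1] := eqVneq (const_mx 1 - t) 0.
    by rewrite normr0.
  have [i [j ->]] := mx_norm_attained t1.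
  rewrite !mxE ord1; have /andP[tj0 tj1] := t_bounds j.
  by rewrite ger0_norm ?subr_ge0 // ltrBlDr ltrDl.
have contract (v : 'cV[R]_n) : `|(1%:M - diag_mx t) *m W *m v| <= q * `|v|.
  apply: mx_norm_le => [|i j]; first by rewrite mulr_ge0 ?normr_ge0.
  rewrite ord1 -mulmxA stubborn_entry normrM ler_pM //.
    by have := ler_mx_norm_entry (const_mx 1 - t) 0 i; rewrite !mxE.
  by rewrite (le_trans (ler_mx_norm_entry _ _ _)) // stochastic_contract.
have dist k : `|x - fj_state W (diag_mx t) y0 k| <= geometric `|x - y0| q k.
  rewrite /geometric /=; elim: k => [|k IH]; first by rewrite expr0 mulr1.
  rewrite /= {1}xE opprD addrACA subrr addr0 -mulmxBr.
  rewrite (le_trans (contract _)) // exprS mulrCA.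
  by rewrite ler_wpM2l // /q normr_ge0.
apply/cvgrPdist_le => e e0.
have /cvgr0Pnorm_le /(_ _ e0) := cvg_geometric `|x - y0| q_lt1.
apply: filterS => k; apply: le_trans.
by rewrite (le_trans (dist k)) // ler_norm.
Qed.

End FriedkinJohnsenLimit.

(** * The left eigenvector and the deflated Laplacian *)

Context (alpha : 'cV[R]_n).
Hypothesis alpha_normalized : (alpha^T *m ones) 0 0 = 1.

Lemma left_eigen_ones : alpha^T *m ones = 1%:M.
Proof. by apply/matrixP => i j; rewrite !ord1 alpha_normalized mxE. Qed.

(** For [x] in the kernel, pairing with [alpha^T] kills the Laplacian part and leaves
    [alpha^T *m x = 0]. Then [W *m x = x], so [x] is constant, and its value is [alpha^T *m x]. *)
Lemma deflated_laplacian_unit :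
  irreducible_mx W -> alpha^T *m W = alpha^T ->
  1%:M - W + ones *m alpha^T \in unitmx.
Proof.
move=> W_irr alphaW; rewrite -unitmx_tr -row_free_unit.
apply: inj_row_free => v /(congr1 trmx).
rewrite trmx_mul trmxK trmx0 => Bv; apply: trmx_inj; rewrite trmx0.
move: (v^T) Bv => {v} x Bx.
have alphax : alpha^T *m x = 0.
  have := congr1 (mulmx alpha^T) Bx.
  rewrite mulmxA mulmxDr mulmxBr mulmx1 alphaW subrr add0r.
  by rewrite (mulmxA _ ones) left_eigen_ones mul1mx mulmx0.
move: Bx; rewrite mulmxDl mulmxBl mul1mx -mulmxA alphax mulmx0 addr0.
move=> /subr0_eq/esym/harmonic_const xconst.
apply/colP => i; rewrite mxE.
have xE : x = ones *m (x i 0)%:M.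
  by apply/colP => j; rewrite mul_mx_scalar !mxE mulr1 (xconst W_irr j i).
have := alphax; rewrite {1}xE mulmxA left_eigen_ones mul1mx.
by move=> /matrixP/(_ 0 0); rewrite !mxE.
Qed.

End Stochastic.

(** * Asymptotics for small stubbornness *)

Unset Implicit Arguments.

Theorem corollary1 (R : realType) (n : nat) (W : 'M[R]_n) (alpha : 'cV[R]_n)
    (eps : R) (p : 'rV[R]_n) (y0 : 'cV[R]_n)
    (W_stochastic : row_stochastic W)
    (W_irreducible : irreducible_mx W)
    (alpha_ge0 : forall i, 0 <= alpha i 0)
    (alpha_eigen : alpha^T *m W = alpha^T)
    (alpha_normalized : (alpha^T *m ones) 0 0 = 1)
    (eps_bounds : 0 < eps < 1)
    (p_bounds : forall i, 0 < p 0 i <= 1)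
    (p_max : \big[Num.max/0]_i p 0 i = 1)
    (y0_bounds : forall i, 0 <= y0 i 0 <= 1) :
  let St := diag_mx p in
  let ybar := fj_limit W St y0 in
  [/\ forall s : R, 0 < s <= 1 - eps -> fj_state W (s *: St) y0 @ \oo --> ybar s,
      exists sbar M' : R, [/\ 0 < sbar <= 1 - eps, 0 < M' &
        forall s : R, 0 < s <= sbar ->
          enorm (ybar s - Hbar alpha St *m y0) <= M' * s] &
      forall i j : 'I_n, exists sbar M : R, [/\ 0 < sbar <= 1 - eps, 0 < M &
        forall s : R, 0 < s <= sbar ->
          `|ybar s i 0 - ybar s j 0| < M * s]].
Proof.
move=> St ybar; have /andP[eps0 eps1] := eps_bounds.
have sbounds (s : R) (i : 'I_n) : 0 < s <= 1 - eps -> 0 < (s *: p) 0 i <= 1.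
  move=> /andP[s0 s1]; have /andP[pi0 pi1] := p_bounds i.
  rewrite mxE mulr_gt0 //= mulr_ile1 ?(ltW s0) ?(ltW pi0) //.
  by rewrite (le_trans s1) // lerBlDr lerDl ltW.
have StZ (s : R) : s *: St = diag_mx (s *: p) by rewrite linearZ.
have ybarP (s : R) : 0 < s <= 1 - eps ->
    fj_state W (s *: St) y0 @ \oo --> ybar s /\
      ybar s = (1%:M - s *: St) *m W *m ybar s + s *: St *m y0.
  move=> sb; rewrite /ybar /fj_limit StZ.
  have [x xE] := fj_fixpoint_exists W_stochastic (fun i => sbounds s i sb) y0.
  have xlim := fj_state_cvg W_stochastic (fun i => sbounds s i sb) xE.
  by rewrite (cvg_lim _ xlim) //; exact: norm_hausdorff.
have y0_le1 : `|y0| <= 1.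
  apply: mx_norm_le => // i j; rewrite ord1.
  by have /andP[? ?] := y0_bounds i; rewrite ger0_norm.
pose b := alpha^T *m St; pose b1 := (b *m ones) 0 0.
(* The sum has nonnegative terms; were it 0, positivity of each [p 0 i] would force [alpha = 0],
   against its normalization. *)
have b1_gt0 : 0 < b1.
  have b1E : b1 = \sum_i alpha i 0 * p 0 i.
    rewrite /b1 mxE; apply: eq_bigr => i _.
    by rewrite /b mul_mx_diag !mxE mulr1.
  have terms_ge0 i : true -> 0 <= alpha i 0 * p 0 i.
    by move=> _; have /andP[/ltW p0 _] := p_bounds i; rewrite mulr_ge0.
  rewrite lt0r b1E sumr_ge0 // andbT; apply/eqP => /(psumr_eq0P terms_ge0) H.
  move/eqP: alpha_normalized; rewrite mxE big1 ?(eq_sym 0) ?oner_eq0 // => i _.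
  have /eqP := H i isT; rewrite mulf_eq0 !mxE.
  have /andP[/lt0r_neq0/negPf-> _] := p_bounds i.
  by rewrite orbF => /eqP->; rewrite mul0r.
pose B := 1%:M - W + ones *m alpha^T.
pose T := 1%:M - b1^-1 *: (ones *m (b *m W)).
have T1 : T *m ones = 0.
  rewrite mulmxBl mul1mx -scalemxAl -!mulmxA (stochastic_ones W_stochastic).
  rewrite (mulmxA (alpha^T)) -/b (mx11_scalar (b *m ones)) -/b1.
  by rewrite mul_mx_scalar scalerA mulVf ?scale1r ?subrr // gt_eqF.
have Bu : B \in unitmx by exact: deflated_laplacian_unit.
(* [n] is the cost of submultiplicativity in the sup norm; 2 bounds [St *m (y0 - W *m x)], as [y0]
   and [W *m x] have norm at most 1. *)
pose K := n%:R * `|T *m invmx B| * 2.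
have K_ge0 : 0 <= K by rewrite !mulr_ge0.
have dist (s : R) : 0 < s <= 1 - eps -> `|ybar s - Hbar alpha St *m y0| <= K * s.
  move=> sb; have [_ xE] := ybarP s sb; set x := ybar s in xE *.
  have /andP[s0 _] := sb.
  have lapE : x - W *m x = s *: (St *m (y0 - W *m x)).
    rewrite {1}xE mulmxBl mul1mx mulmxBl -!scalemxAl -mulmxA.
    by rewrite addrAC [_ - _ - W *m x]addrAC subrr add0r addrC -scalerBr -mulmxBr.
  (* [alpha^T] annihilates [x - W *m x], and the factor [s] is nonzero. *)
  have bE : b *m y0 = b *m (W *m x).
    apply/eqP; rewrite -subr_eq0 -mulmxBr /b -mulmxA.
    have /eqP : s *: (alpha^T *m (St *m (y0 - W *m x))) = 0.
      by rewrite scalemxAr -lapE mulmxBr mulmxA alpha_eigen subrr.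
    by rewrite scaler_eq0 gt_eqF.
  (* The subtracted constant makes the [alpha]-mean 0, where [B] acts as [1%:M - W]; constants
     themselves are killed by [1%:M - W]. *)
  have BE : B *m (x - ones *m (alpha^T *m x)) = x - W *m x.
    rewrite mulmxDl mulmxBr !mulmxBl !mul1mx.
    rewrite (mulmxA W) (stochastic_ones W_stochastic) subrr subr0.
    rewrite -!mulmxA mulmxBr (mulmxA _ ones) left_eigen_ones //.
    by rewrite mul1mx subrr mulmx0 addr0.
  have errE : x - Hbar alpha St *m y0 = T *m invmx B *m (x - W *m x).
    rewrite -BE -mulmxA mulKmx // mulmxBr (mulmxA T) T1 mul0mx subr0.
    rewrite /T mulmxBl mul1mx /Hbar -/b -/b1 -!scalemxAl -!mulmxA.
    by rewrite (mulmxA (alpha^T)) -/b bE !mulmxA.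
  have x_le1 : `|x| <= 1.
    apply: le_trans y0_le1.
    apply: (fj_fixpoint_bound W_stochastic (fun i => sbounds s i sb)).
    by rewrite -StZ.
  rewrite errE lapE -scalemxAr normrZ gtr0_norm // mulrC ler_pM2r //.
  rewrite (le_trans (ler_norm_mulmx _ _)) // ler_wpM2l ?mulr_ge0 //.
  apply: mx_norm_le => // i j; rewrite ord1 mul_diag_mx mxE normrM.
  have /andP[p0 p1] := p_bounds i; rewrite gtr0_norm // -[2]mul1r.
  rewrite ler_pM ?(ltW p0) //; apply: le_trans (ler_mx_norm_entry _ _ _) _.
  rewrite (le_trans (ler_normB _ _)) // -[2]/(1 + 1) lerD //.
  by rewrite (le_trans (stochastic_contract W_stochastic _)).
split=> [s /ybarP[]//||i j].
  (* The estimate [dist] holds on the whole admissible range of [s]. [Num.sqrt n%:R] passes to the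
     Euclidean norm, and adding 1 keeps the constant positive if [K = 0]. *)
  exists (1 - eps), (Num.sqrt n%:R * K + 1); split=> [||s sb].
  - by rewrite subr_gt0 eps1 lexx.
  - by rewrite ltr_wpDl // mulr_ge0 // sqrtr_ge0.
  have /andP[s0 _] := sb.
  rewrite (le_trans (enorm_le _)) // mulrDl mul1r ler_wpDr ?(ltW s0) // -mulrA.
  by rewrite ler_wpM2l ?sqrtr_ge0 ?dist.
(* Each of the two entries costs [K * s]; the extra 1 makes the inequality strict. *)
exists (1 - eps), (2 * K + 1); split=> [||s sb].
- by rewrite subr_gt0 eps1 lexx.
- by rewrite ltr_wpDl // mulr_ge0.
have /andP[s0 _] := sb.
pose z := ybar s - Hbar alpha St *m y0.
(* All entries of [Hbar alpha St *m y0] coincide, so they cancel in the difference. *)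
have -> : ybar s i 0 - ybar s j 0 = z i 0 - z j 0.
  have zE k : z k 0 = ybar s k 0 - b1^-1 * (b *m y0) 0 0.
    rewrite /z /Hbar -/b -/b1 -scalemxAl -mulmxA mxE [X in _ + X]mxE.
    congr (_ - _); rewrite mxE; congr (_ * _).
    by rewrite mxE big_ord1 mxE mul1r.
  by rewrite !zE opprB addrA subrK.
rewrite mulrDl mul1r (@le_lt_trans _ _ (2 * K * s)) ?ltrDl //.
rewrite (le_trans (ler_normB _ _)) // -mulrA mulr_natl mulr2n.
by rewrite lerD // (le_trans (ler_mx_norm_entry _ _ _)) ?dist.
Qed.
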